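(* Let $H$ be an infinite-dimensional Hilbert space, and let $F\mathcal P(H)=\{\delta^T\in B\mathcal P(H):T\in\mathcal S\}$ be the normed algebra contained in $B\mathcal P(H)$, which is isomorphic to the normed algebra $B\mathcal F(H)$. Then the closure $\overline{F\mathcal P(H)}$ of $F\mathcal P(H)$ in $B\mathcal P(H)$ is a Banach algebra isomorphic to the Banach algebra $\mathcal K$ of all compact operators on $H$.
   Context: $H$ is a Hilbert space over $\mathbf K=\mathbb R$ or $\mathbb C$. Composition is written from left to right ($T_1T_2$ means first $T_1$, then $T_2$). $\mathcal S$ is the normed algebra of finite rank bounded operators on $H$ and $\mathcal K$ the Banach algebra of compact operators, both with the operator norm. $\mathcal F(H)$ is the category of finite-dimensional subspaces of $H$ and linear maps. A cone in it with vertex $N$ assigns to each finite-dimensional subspace $M$ a linear map $\gamma(M):M\to N$, compatible with restriction to subspaces; it is normal if some component is an isomorphism, and bounded if the norms of its components are uniformly bounded. For $T\in\mathcal S$, $\gamma^T$ is the bounded normal cone with vertex $R(T)$ (the range) and $\gamma^T(M)=T|_M$. $B\mathcal F(H)=\{\gamma^T:T\in\mathcal S\}$ is the normed algebra of bounded normal cones in $\mathcal F(H)$, with $\gamma^{T_1}+\gamma^{T_2}=\gamma^{T_1+T_2}$, $k\gamma^T=\gamma^{kT}$, $\gamma^{T_1}\cdot\gamma^{T_2}=\gamma^{T_1T_2}$, $\|\gamma^T\|=\|T\|$. $\mathcal P(H)$ is the category of proper (linear) subspaces of $H$ and all linear maps between them. For a non-surjective linear operator $T$ on $H$, $\delta^T$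 is the cone with vertex $R(T)$ given by $\delta^T(M)=T|_M:M\to R(T)$ for each proper subspace $M$. $B\mathcal P(H)$ denotes the semigroup of bounded normal cones in $\mathcal P(H)$; it is identified with the semigroup of non-surjective bounded operators on $H$ via $T\mapsto\delta^T$, i.e. $B\mathcal P(H)=\{\delta^T:T\text{ a non-surjective bounded operator on }H\}$ with $\delta^{T_1}\cdot\delta^{T_2}=\delta^{T_1T_2}$. A sequence $(\delta^{T_n})$ in $B\mathcal P(H)$ converges in $B\mathcal P(H)$ (to $\delta^T$) if there is $\delta^T\in B\mathcal P(H)$ with $\|T_n-T\|\to0$; closure is taken with respect to this convergence. The algebra operations and norm on $F\mathcal P(H)$, and on its closure, are $\delta^{T_1}+\delta^{T_2}=\delta^{T_1+T_2}$, $k\delta^T=\delta^{kT}$, $\delta^{T_1}\cdot\delta^{T_2}=\delta^{T_1T_2}$, $\|\delta^T\|=\|T\|$. *)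

(* Defs.v *)
From HB Require Import structures.
From mathcomp Require Import all_boot all_order all_algebra sesquilinear.
From mathcomp Require Import complex.
From mathcomp Require Import all_classical all_reals all_analysis.

Set Implicit Arguments.
Unset Strict Implicit.
Unset Printing Implicit Defensive.

Import Order.TTheory GRing.Theory Num.Theory.
Import numFieldNormedType.Exports.

Local Open Scope classical_set_scope.
Local Open Scope ring_scope.

Variant scalar_kind := RealScalars | ComplexScalars.

Definition scalars (R : realType) (k : scalar_kind) : numFieldType :=
  match k with
  | RealScalars => R
  | ComplexScalars => R[i]
  end.

Definition scalar_conj (R : realType) (k : scalar_kind) :
    scalars R k -> scalars R k :=
  match k with
  | RealScalars => idfun
  | ComplexScalars => @conjc R
  end.

(* Algebras are associative but need not have a unit. *)
Record normedAlgebra (K : numFieldType) := NormedAlgebra {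
  nalg_sort :> normedModType K;
  nalg_mul : nalg_sort -> nalg_sort -> nalg_sort;
  nalg_mulA : associative nalg_mul;
  nalg_mulDl : left_distributive nalg_mul +%R;
  nalg_mulDr : right_distributive nalg_mul +%R;
  nalg_scaleAl : forall (k : K) x y, nalg_mul (k *: x) y = k *: nalg_mul x y;
  nalg_scaleAr : forall (k : K) x y, nalg_mul x (k *: y) = k *: nalg_mul x y;
  nalg_normM : forall x y, `|nalg_mul x y| <= `|x| * `|y|
}.

Definition banach (K : numFieldType) (A : normedAlgebra K) : Prop :=
  forall F : set_system A, ProperFilter F -> cauchy F -> cvg F.

Definition isometrically_isomorphic (K : numFieldType)
    (A B : normedAlgebra K) : Prop :=
  exists f : {linear A -> B},
    [/\ bijective f,
        forall x y, f (nalg_mul x y) = nalg_mul (f x) (f y)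
      & forall x, `|f x| = `|x|].

Section Subspaces.
Variables (K : numFieldType) (H : normedModType K).

Record subspace := Subspace {
  subspace_pred :> H -> bool;
  subspace_closed : submod_closed subspace_pred
}.

Canonical subspace_predType := PredType subspace_pred.

HB.instance Definition _ (M : subspace) :=
  GRing.isSubmodClosed.Build K H (subspace_pred M) (subspace_closed M).

Record vec (M : subspace) := Vec {
  vec_val : H;
  vec_valP : vec_val \in subspace_pred M
}.

HB.instance Definition _ (M : subspace) := [isSub for @vec_val M].
HB.instance Definition _ (M : subspace) := [Choice of vec M by <:].
HB.instance Definition _ (M : subspace) :=
  [SubChoice_isSubLmodule of vec M by <:].

Definition incl (M M' : subspace) (sMM' : {subset M <= M'}) (x : vec M) :
    vec M' :=
  Vec (sMM' _ (vec_valP x)).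

Definition finite_dim (M : H -> bool) : Prop :=
  exists (n : nat) (e : 'I_n -> H), forall x,
    x \in M <-> exists c : 'I_n -> K, x = \sum_(i < n) c i *: e i.

Definition proper_subspace (M : H -> bool) : Prop := exists x, x \notin M.

Section Range.
Variable T : {linear H -> H}.

Fact range_closed : submod_closed (mem (range T)).
Proof.
split; first by apply/mem_set; exists 0; rewrite ?linear0.
move=> a u v /set_mem[x _ <-] /set_mem[y _ <-].
by apply/mem_set; exists (a *: x + y); rewrite ?linearP.
Qed.

Definition range_subspace : subspace := Subspace range_closed.

Fact mem_range_subspace (x : H) : T x \in range_subspace.
Proof. by apply/mem_set; exists x. Qed.

Variable M : subspace.

Definition restriction (x : vec M) : vec range_subspace :=
  Vec (mem_range_subspace (vec_val x)).

Fact restriction_linear : linear restriction.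
Proof. by move=> a x y; apply/val_inj; rewrite /= linearP. Qed.

HB.instance Definition _ :=
  GRing.isLinear.Build K (vec M) (vec range_subspace) _ restriction
    restriction_linear.

End Range.

(* Cones in the full subcategory, of the category of subspaces of H and all
   linear maps, whose objects satisfy P. *)
Record cone (P : (H -> bool) -> Prop) := Cone {
  vertex : subspace;
  vertexP : P vertex;
  component : forall M : subspace, P M -> {linear vec M -> vec vertex};
  component_incl : forall (M M' : subspace) (hM : P M) (hM' : P M')
    (sMM' : {subset M <= M'}) (x : vec M),
    component hM' (incl sMM' x) = component hM x
}.

Definition normal_cone P (c : cone P) : Prop :=
  exists (M : subspace) (hM : P M), bijective (component c hM).

Definition bounded_cone P (c : cone P) : Prop :=
  exists C : K, forall (M : subspace) (hM : P M) (x : vec M),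
    `|vec_val (component c hM x)| <= C * `|vec_val x|.

Fact range_cone_incl (T : {linear H -> H}) (M M' : subspace)
    (sMM' : {subset M <= M'}) (x : vec M) :
  restriction T (incl sMM' x) = restriction T x.
Proof. exact/val_inj. Qed.

Definition range_cone (P : (H -> bool) -> Prop) (T : {linear H -> H})
    (hT : P (range_subspace T)) : cone P :=
  @Cone P (range_subspace T) hT (fun M _ => restriction T (M := M))
    (fun M M' _ _ sMM' x => range_cone_incl T sMM' x).

Definition bounded_op (T : H -> H) : Prop :=
  exists C : K, forall x, `|T x| <= C * `|x|.

(* For T bounded the set below is nonempty, bounded and consists of
   nonnegative reals; [supremum] is taken for the order of K, which for
   K = R[i] compares complex numbers with the same imaginary part. *)
Definition opnorm (T : H -> H) : K :=
  supremum 0 [set `|T x| | x in [set x : H | `|x| <= 1]].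

Definition finite_rank (T : {linear H -> H}) : Prop :=
  bounded_op T /\ finite_dim (range_subspace T).

Definition compact_op (T : {linear H -> H}) : Prop :=
  compact (closure (T @` [set x : H | `|x| <= 1])).

(* T represents c when c is gamma^T (for P := finite_dim) or delta^T (for
   P := proper_subspace). *)
Definition represents (P : (H -> bool) -> Prop) (T : {linear H -> H})
    (c : cone P) : Prop :=
  bounded_op T /\ exists hT : P (range_subspace T), c = range_cone hT.

Definition BF : set (cone finite_dim) :=
  [set c | normal_cone c /\ bounded_cone c].

(* The set of all delta^T, T bounded and not surjective.  Normality in the
   sense of [normal_cone] is not imposed: if T is injective but not
   surjective, then no restriction of T to a proper subspace is onto the
   range of T. *)
Definition BP : set (cone proper_subspace) :=
  [set c | exists T, represents T c].

Definition FP : set (cone proper_subspace) :=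
  [set c | BP c /\ exists2 T, finite_rank T & represents T c].

Definition BP_cvg (u : nat -> cone proper_subspace)
    (c : cone proper_subspace) : Prop :=
  exists (T_ : nat -> {linear H -> H}) (T : {linear H -> H}),
    [/\ forall n, represents (T_ n) (u n),
        represents T c
      & (fun n => opnorm (T_ n \- T)) @ \oo --> (0 : K)].

Definition FP_closure : set (cone proper_subspace) :=
  [set c | exists2 u : nat -> cone proper_subspace,
             forall n, FP (u n) & BP_cvg u c].

Definition compacts : set {linear H -> H} := [set T | compact_op T].

(* A normed algebra structure on the set C of objects represented by operators
   (through [rep]), whose operations and norm are those of the representing
   operators.  The sum of two elements of BP need not be in BP, so these
   operations cannot be given on BP once and for all.  Products are written
   from left to right: T1 T2 is T2 \o T1. *)
Record operator_algebra (X : Type) (rep : {linear H -> H} -> X -> Prop)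
    (C : set X) := OperatorAlgebra {
  opalg :> normedAlgebra K;
  opalg_elt : opalg -> X;
  opalg_elt_inj : injective opalg_elt;
  opalg_eltE : range opalg_elt = C;
  opalg_rep : forall a, exists T, rep T (opalg_elt a);
  opalg_add : forall (T1 T2 : {linear H -> H}) a b,
    rep T1 (opalg_elt a) -> rep T2 (opalg_elt b) ->
    rep (T1 \+ T2) (opalg_elt (a + b));
  opalg_scale : forall (k : K) (T : {linear H -> H}) a,
    rep T (opalg_elt a) -> rep (k \*: T) (opalg_elt (k *: a));
  opalg_mul : forall (T1 T2 : {linear H -> H}) a b,
    rep T1 (opalg_elt a) -> rep T2 (opalg_elt b) ->
    rep (T2 \o T1) (opalg_elt (nalg_mul a b));
  opalg_norm : forall (T : {linear H -> H}) a,
    rep T (opalg_elt a) -> `|a| = opnorm T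
}.

End Subspaces.

Arguments BF {K} H.
Arguments FP {K} H.
Arguments FP_closure {K} H.
Arguments compacts {K} H.

(* Main.v *)
Require Import Defs.
From HB Require Import structures.
From mathcomp Require Import all_boot all_order all_algebra sesquilinear.
From mathcomp Require Import complex ring.
From mathcomp Require Import all_classical all_reals all_analysis.
Set Implicit Arguments.
Unset Strict Implicit.
Unset Printing Implicit Defensive.
Import Order.TTheory GRing.Theory Num.Theory.
Import numFieldNormedType.Exports.
Local Open Scope classical_set_scope.
Local Open Scope ring_scope.

(** Since H is infinite-dimensional, every vector lies in a finite-dimensional,
    hence proper, subspace, so a cone of restrictions T|_M determines T.  All
    four algebras are therefore algebras of operators, and it is enough to
    identify which operators occur in each: the isomorphisms are then identity
    maps.

    - A finite rank operator is not onto, so FP(H) consists of all delta^T with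
      T bounded of finite rank ([FPE]).  A bounded normal cone in the category
      of finite-dimensional subspaces glues, along lines, to one linear
      operator; boundedness of the cone makes it bounded, and normality makes
      the vertex its range ([bounded_normal_coneP]).  So FP(H) and BF(H) are
      both the algebra of bounded operators of finite rank.

    - The closure of FP(H) consists of all delta^T with T compact
      ([FP_closureE]).  Compactness of T means that T maps the unit ball to a
      totally bounded set ([compact_opP]), a condition visibly stable under
      limits in operator norm and true for finite rank operators.  Conversely,
      if y_1, ..., y_n is an e-net of the image of the ball and P the orthogonal
      projection onto the span of the y_i, then T followed by P has finite rank
      and is within e of T ([compact_finite_rank_approx]).  A compact operator T
      does give an element of BP(H), because it is not onto
      ([compact_op_not_surjective]): T maps each ball into a small neighbourhood
      of a finite-dimensional subspace, and a convergent series of orthogonal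
      corrections produces a vector that avoids the images of all balls.

    - The compact operators are complete for the operator norm: a Cauchy filter
      converges pointwise, uniformly on the unit ball, and the limit is compact
      by stability under limits ([compact_ops_banach]).

    Real and complex scalars are treated together.  Apart from the fact that
    conjugation fixes 0, which makes orthogonality symmetric, three properties
    of the scalar field suffice: it is archimedean, a nonempty bounded set of
    nonnegative elements has a supremum, and discs are totally bounded. *)

(** * The scalar field *)

Section Scalars.
Variables (R : realType) (k : scalar_kind).
Local Notation K := (scalars R k).

Lemma scalar_archi (a : K) : 0 <= a -> exists n : nat, a <= n%:R.
Proof.
case: k a => /= a a0.
  by exists (Num.truncn a).+1; rewrite ltW ?truncnS_gt.
exists (Num.truncn (complex.Re a)).+1.
rewrite -[leLHS]RRe_real ?ger0_real// -(rmorph_nat (real_complex R)) lecR.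
by rewrite ltW ?truncnS_gt.
Qed.

Lemma scalar_invn (e : K) : 0 < e -> exists n : nat, n.+1%:R^-1 < e.
Proof.
move=> e0; have [|n en] := @scalar_archi e^-1; first by rewrite invr_ge0 ltW.
exists n; rewrite -[e]invrK ltf_pV2 ?posrE ?invr_gt0 ?ltr0Sn//.
by rewrite (le_lt_trans en) ?ltr_nat.
Qed.

(** Complex numbers are only partially ordered, but nonnegative ones are real,
    so the supremum is that of the real parts. *)
Lemma scalar_supremums (A : set K) : A !=set0 -> (forall x, A x -> 0 <= x) ->
  ubound A !=set0 -> supremums A !=set0.
Proof.
case: k A => /= A A0 Age0 [b ubb].
  have supA : has_sup A by split => //; exists b.
  exists (sup A); split; first exact: sup_upper_bound.
  by move=> y; exact: ge_sup.
have ImA x : A x -> x = (complex.Re x)%:C%C.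
  by move=> Ax; rewrite RRe_real// ger0_real// Age0.
pose B := @complex.Re R @` A.
have supB : has_sup B.
  split; first by have [x Ax] := A0; exists (complex.Re x), x.
  exists (complex.Re b) => _ [x Ax <-]; have := ubb _ Ax.
  by rewrite lecE => /andP[].
exists (sup B)%:C%C; split.
  move=> x Ax; rewrite (ImA x Ax) lecR.
  by apply: (sup_upper_bound supB); exists x.
move=> y uby; have [x0 Ax0] := A0.
have y0 : 0 <= y by rewrite (le_trans (Age0 _ Ax0))// uby.
rewrite -[y]RRe_real ?ger0_real// lecR; apply: ge_sup; first exact: supB.1.
by move=> _ [x Ax <-]; have := uby _ Ax; rewrite lecE => /andP[].
Qed.

Lemma real_net (M e : R) : 0 < e ->
  exists s : seq R, forall c, `|c| <= M -> exists2 d, d \in s & `|c - d| < e.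
Proof.
move=> e0; pose N := (Num.truncn ((M + M) / e)).+1.
exists [seq - M + i%:R * e | i <- iota 0 N] => c cM.
have /andP[cM1 cM2] : - M <= c <= M by rewrite -ler_norml.
have q0 : 0 <= (c + M) / e by rewrite divr_ge0 ?(ltW e0)// -lerBlDr sub0r.
exists (- M + (Num.truncn ((c + M) / e))%:R * e).
  apply/mapP; exists (Num.truncn ((c + M) / e)) => //.
  rewrite mem_iota leq0n add0n /= ltnS le_truncn//.
  by rewrite ler_wpM2r ?invr_ge0 ?(ltW e0)// lerD2r.
have /andP[t1 t2] := truncn_itv q0.
rewrite opprD opprK addrA ger0_norm; last first.
  by rewrite subr_ge0 -ler_pdivlMr.
have : c + M < (Num.truncn ((c + M) / e)).+1%:R * e by rewrite -ltr_pdivrMr.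
by rewrite mulrSr mulrDl mul1r ltrBlDl.
Qed.

(** Total boundedness of discs, by a grid of real and imaginary parts. *)
Lemma scalar_net (M e : K) : 0 < e ->
  exists s : seq K, forall c, `|c| <= M -> exists2 d, d \in s & `|c - d| < e.
Proof.
case: k M e => /= M e e0; first exact: real_net.
have eR : e = (complex.Re e)%:C%C by rewrite RRe_real ?ger0_real ?ltW.
have e20 : 0 < complex.Re e / 2 by rewrite divr_gt0// -ltcR -eR.
have [s sP] := real_net (complex.Re M) e20.
exists [seq (a +i* b)%C | a <- s, b <- s] => -[a b] cM.
have cM' : Num.sqrt (a ^+ 2 + b ^+ 2) <= complex.Re M.
  by have := cM; rewrite normc_def lecE => /andP[].
have aM : `|a| <= complex.Re M.
  by rewrite (le_trans _ cM')// -sqrtr_sqr ler_wsqrtr// lerDl sqr_ge0.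
have bM : `|b| <= complex.Re M.
  by rewrite (le_trans _ cM')// -sqrtr_sqr ler_wsqrtr// lerDr sqr_ge0.
have [a' a's aa'] := sP _ aM; have [b' b's bb'] := sP _ bM.
exists (a' +i* b')%C; first exact: allpairs_f.
have -> : (a +i* b)%C - (a' +i* b')%C = (a - a')%:C%C + 'i%C * (b - b')%:C%C.
  by simpc.
rewrite (le_lt_trans (ler_normD _ _))// normrM !normc_def/=.
rewrite !expr0n/= !addr0 add0r expr1n sqrtr1 mul1r !sqrtr_sqr eR.
by rewrite -rmorphD ltcR (splitr (complex.Re e)) ltrD.
Qed.

End Scalars.

(** * Spans of finite lists *)

Section Spans.
Variables (K : numFieldType) (H : normedModType K).
Implicit Types (s : seq H) (x y v : H) (M : Defs.subspace H).
Implicit Types T : {linear H -> H}.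

(** The recursion on the list lets every statement about spans be proved by
    adjoining one vector at a time. *)
Fixpoint lspan s : set H :=
  if s is y :: s' then [set x | exists c : K, lspan s' (x - c *: y)]
  else [set 0].

Lemma lspan0 s : lspan s 0.
Proof. by elim: s => //= y s IH; exists 0; rewrite scale0r subr0. Qed.

Lemma lspanP s a x y : lspan s x -> lspan s y -> lspan s (a *: x + y).
Proof.
elim: s x y => [|z s IH] x y /=; first by move=> -> ->; rewrite scaler0 addr0.
move=> [c xc] [d yd]; exists (a * c + d).
have -> : a *: x + y - (a * c + d) *: z = a *: (x - c *: z) + (y - d *: z).
  by rewrite scalerBr scalerDl scalerA opprD addrACA.
exact: IH.
Qed.

Lemma lspanD s x y : lspan s x -> lspan s y -> lspan s (x + y).
Proof. by move=> sx sy; rewrite -[x]scale1r; exact: lspanP. Qed.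

Lemma lspanZ s a x : lspan s x -> lspan s (a *: x).
Proof.
by move=> sx; rewrite -[_ *: _]addr0; apply: lspanP => //; exact: lspan0.
Qed.

Lemma lspanB s x y : lspan s x -> lspan s y -> lspan s (x - y).
Proof. by move=> sx sy; rewrite -scaleN1r; apply/lspanD/lspanZ. Qed.

Lemma lspan_behead y s x : lspan s x -> lspan (y :: s) x.
Proof. by move=> sx; exists 0; rewrite scale0r subr0. Qed.

Lemma lspan_mem s x : x \in s -> lspan s x.
Proof.
elim: s => //= y s IH; rewrite inE => /orP[/eqP->|/IH]; last first.
  exact: lspan_behead.
by exists 1; rewrite scale1r subrr; exact: lspan0.
Qed.

Lemma lspan_cat s t x y : lspan s x -> lspan t y -> lspan (s ++ t) (x + y).
Proof.
elim: s x => [|z s IH] x /= sx ty; first by rewrite sx add0r.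
by have [c sxc] := sx; exists c; rewrite addrAC; exact: IH.
Qed.

Fact lspan_closed s : submod_closed (mem (lspan s)).
Proof.
split; first exact/mem_set/lspan0.
by move=> a x y /set_mem sx /set_mem sy; exact/mem_set/lspanP.
Qed.

Definition span_subspace s : Defs.subspace H := Subspace (lspan_closed s).

Lemma mem_span_subspace s x : x \in span_subspace s <-> lspan s x.
Proof. by split => [/set_mem|] // sx; exact/mem_set. Qed.

(** Turns linear combinations indexed by ordinals into the recursive form of
    [lspan]. *)
Lemma sum_recP n (e : 'I_n.+1 -> H) x :
  (exists c : 'I_n.+1 -> K, x = \sum_(i < n.+1) c i *: e i) <->
  exists (d : K) (c : 'I_n -> K),
    x - d *: e ord0 = \sum_(i < n) c i *: e (lift ord0 i).
Proof.
split=> [[c ->]|[d [c xE]]].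
  exists (c ord0), (c \o lift ord0).
  by rewrite big_ord_recl addrAC subrr add0r.
exists (fun i => if unlift ord0 i is Some j then c j else d).
rewrite big_ord_recl unlift_none -[x](subrK (d *: e ord0)) addrC xE.
by congr (_ + _); apply: eq_bigr => i _; rewrite liftK.
Qed.

Lemma lspan_sum s x :
  lspan s x <-> exists c : 'I_(size s) -> K, x = \sum_i c i *: s`_i.
Proof.
elim: s x => [|y s IH] x /=.
  by split=> [->|[c ->]]; [exists (fun=> 0)|]; rewrite big_ord0.
rewrite (sum_recP (fun i : 'I_(size s).+1 => (y :: s)`_i)).
split=> -[d sd]; exists d; first exact: (IH _).1 sd.
exact: (IH _).2 sd.
Qed.

Lemma finite_dimP (M : H -> bool) :
  finite_dim M <-> exists s, forall x, x \in M <-> lspan s x.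
Proof.
split=> [[n [e eM]]|[s sM]]; last first.
  exists (size s), (fun i => s`_i) => x.
  by split=> [/sM/lspan_sum//|?]; exact/sM/lspan_sum.
suff [s sE] : exists s, forall x,
    lspan s x <-> exists c : 'I_n -> K, x = \sum_i c i *: e i.
  by exists s => x; rewrite sE.
elim: n e {eM} => [|n IH] e.
  exists [::] => x.
  by split=> [->|[c ->]]; [exists (fun=> 0)|]; rewrite big_ord0.
have [s sE] := IH (e \o lift ord0); exists (e ord0 :: s) => x.
rewrite sum_recP; split=> -[d sd]; exists d; first exact: (sE _).1 sd.
exact: (sE _).2 sd.
Qed.

Lemma finite_dim_span s : finite_dim (span_subspace s).
Proof. by apply/finite_dimP; exists s => x; exact: mem_span_subspace. Qed.

(** If M lies in the span of y :: s, a spanning list of M is obtained from one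
    of its intersection with the span of s, adding any vector of M outside that
    intersection. *)
Lemma lspan_sub s (M : set H) : M 0 ->
  (forall a x y, M x -> M y -> M (a *: x + y)) ->
  M `<=` lspan s -> exists s', M = lspan s'.
Proof.
elim: s M => [|y s IH] M M0 Mlin Ms.
  by exists [::]; apply/seteqP; split => // x ->.
have [|a u v [Mu su] [Mv sv]|x []//|s' s'E] := IH (M `&` lspan s).
- by split => //; exact: lspan0.
- by split; [exact: Mlin|exact: lspanP].
have [Mss|] := pselect (M `<=` lspan s).
  exists s'; rewrite -s'E; apply/seteqP; split => [x Mx|x []//].
  by split => //; exact: Mss.
move=> /existsNP[v /not_implyP[Mv nsv]].
have [c svc] := Ms _ Mv.
have c0 : c != 0 by apply/eqP => c0; move: svc; rewrite c0 scale0r subr0.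
exists (v :: s'); apply/seteqP; split=> x.
  move=> Mx; have [d sxd] := Ms _ Mx; exists (d / c); rewrite -s'E; split.
    by rewrite addrC -scaleNr; exact: Mlin.
  have -> : x - (d / c) *: v = (- (d / c)) *: (v - c *: y) + (x - d *: y).
    rewrite scalerBr scalerA mulNr divfK// !scaleNr opprK.
    by rewrite -addrA [d *: y + _]addrC subrK addrC.
  exact: lspanP.
move=> [d] /=; rewrite -/(lspan _) -s'E => -[Mx _].
rewrite -[x](subrK (d *: v)) addrC.
exact: Mlin.
Qed.

Lemma finite_dim_sub s M : (forall x, x \in M -> lspan s x) -> finite_dim M.
Proof.
move=> Ms; have [||x Mx|s' s'E] := @lspan_sub s [set x | x \in M].
- exact: (subspace_closed M).1.
- by move=> a x y; exact: (subspace_closed M).2.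
- exact: Ms.
by apply/finite_dimP; exists s' => x; rewrite -s'E.
Qed.

Lemma mem_rangeP T x : x \in range_subspace T <-> exists y, T y = x.
Proof.
by split=> [/set_mem[y _ <-]|[y <-]]; [exists y|exact: mem_range_subspace].
Qed.

Lemma finite_rank_sub s T : (forall x, lspan s (T x)) ->
  finite_dim (range_subspace T).
Proof. by move=> Ts; apply: (@finite_dim_sub s) => _ /mem_rangeP[x <-]. Qed.

Lemma finite_dim_rangeP T :
  finite_dim (range_subspace T) <-> exists s, forall x, lspan s (T x).
Proof.
split=> [/finite_dimP[s sE]|[s]]; last exact: finite_rank_sub.
by exists s => x; apply/sE/mem_range_subspace.
Qed.

(** When T reaches the whole span of s, it restricts to an isomorphism from some
    finite-dimensional subspace onto that span. *)
Lemma lspan_section s T : (forall y, lspan s y -> exists x, T x = y) ->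
  exists s', [/\ forall y, lspan s y -> exists2 x, lspan s' x & T x = y,
                 forall x, lspan s' x -> lspan s (T x)
               & forall x, lspan s' x -> T x = 0 -> x = 0].
Proof.
elim: s => [|y s IH] sT.
  exists [::]; split=> [y ->|x ->|x ->//]; rewrite ?linear0//.
  by exists 0; rewrite ?linear0.
have [z /(lspan_behead y)/sT//|s' [s's ss' s'0]] := IH.
have [sy|nsy] := pselect (lspan s y).
  have ys x : lspan (y :: s) x -> lspan s x.
    by move=> [c xc]; rewrite -[x](subrK (c *: y)); apply/lspanD/lspanZ.
  exists s'; split=> [x /ys/s's//|x /ss'/(lspan_behead y)//|//].
have [x xy] := sT y (lspan_mem (mem_head _ _)).
exists (x :: s'); split.
- move=> z [c /s's[u s'u uE]]; exists (u + c *: x).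
    by exists c; rewrite addrK.
  by rewrite linearD linearZ /= xy uE subrK.
- by move=> u [c /ss']; rewrite linearB linearZ/= xy => suc; exists c.
- move=> u [c s'u] Tu; have c0 : c = 0.
    apply/eqP/negPn/negP => c0; apply: nsy.
    have := ss' _ s'u; rewrite linearB linearZ/= xy Tu sub0r.
    move=> /(lspanZ (- c^-1)).
    by rewrite scalerN scaleNr opprK scalerA mulVf// scale1r.
  by move: s'u; rewrite c0 scale0r subr0 => /s'0; apply.
Qed.

End Spans.

(** * Bounded operators and operators of finite rank *)

Lemma linear_ext (K : pzRingType) (V W : lmodType K) (T U : {linear V -> W}) :
  (T : V -> W) = U -> T = U.
Proof.
case: T U => [f [[a] [b]]] [g [[a'] [b']]] /= fg; subst g.
by rewrite (Prop_irrelevance a a') (Prop_irrelevance b b').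
Qed.

Section LinearOf.
Variables (K : numFieldType) (H : normedModType K) (f : H -> H).
Hypothesis lin_f : linear f.

Definition linear_of : {linear H -> H} :=
  HB.pack f (GRing.isLinear.Build K H H *:%R f lin_f).

End LinearOf.

Section BoundedOperators.
Variables (K : numFieldType) (H : normedModType K).
Implicit Types T U : {linear H -> H}.

(** A bound may be any scalar, for instance a negative or non-real one when H is
    zero; a positive one can always be taken. *)
Lemma bounded_opP (T : H -> H) : bounded_op T ->
  exists2 C : K, 0 < C & forall x, `|T x| <= C * `|x|.
Proof.
move=> [C CT]; exists (`|C| + 1); first by rewrite ltr_wpDl.
move=> x; rewrite mulrDl mul1r (@le_trans _ _ (`|C| * `|x|))// ?lerDl//.
have := CT x => /[dup] /(le_trans (normr_ge0 _)) Cx.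
by rewrite -[`|C| * _](_ : C * `|x| = _)// -[LHS]ger0_norm// normrM normr_id.
Qed.

Lemma homogeneous_le T (C : K) :
  (forall x, `|x| <= 1 -> `|T x| <= C) -> forall x, `|T x| <= C * `|x|.
Proof.
move=> TC x; have [->|x0] := eqVneq x 0.
  by rewrite linear0 !normr0 mulr0.
have nx0 : 0 < `|x| by rewrite normr_gt0.
have := TC (`|x|^-1 *: x); rewrite linearZ/= !normrZ normfV normr_id.
by rewrite mulVf ?gt_eqF// => /(_ (lexx _)); rewrite ler_pdivrMl// mulrC.
Qed.

Lemma bounded_op0 : bounded_op (\0 : {linear H -> H}).
Proof. by exists 0 => x; rewrite mul0r normr0. Qed.

Lemma bounded_op_lin (a : K) T U :
  bounded_op T -> bounded_op U -> bounded_op (a \*: T \+ U).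
Proof.
move=> [C TC] [D UD]; exists (`|a| * C + D) => x /=.
by rewrite (le_trans (ler_normD _ _))// mulrDl lerD// normrZ -mulrA ler_wpM2l.
Qed.

Lemma bounded_op_comp T U : bounded_op T -> bounded_op U -> bounded_op (U \o T).
Proof.
move=> [C TC] /bounded_opP[D D0 UD]; exists (D * C) => x /=.
by rewrite (le_trans (UD _))// -mulrA ler_wpM2l// ltW.
Qed.

Lemma finite_rank0 : finite_rank (\0 : {linear H -> H}).
Proof.
by split; [exact: bounded_op0|apply: (@finite_rank_sub _ _ [::])].
Qed.

Lemma finite_rank_lin (a : K) T U :
  finite_rank T -> finite_rank U -> finite_rank (a \*: T \+ U).
Proof.
move=> [bT /finite_dim_rangeP[s sT]] [bU /finite_dim_rangeP[t tU]].
split; first exact: bounded_op_lin.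
by apply: (@finite_rank_sub _ _ (s ++ t)) => x; apply/lspan_cat/tU/lspanZ.
Qed.

Lemma finite_rank_comp T U :
  finite_rank T -> finite_rank U -> finite_rank (U \o T).
Proof.
move=> [bT _] [bU /finite_dim_rangeP[s sU]].
split; first exact: bounded_op_comp.
by apply: (@finite_rank_sub _ _ s) => x; exact: sU.
Qed.

End BoundedOperators.

(** * Total boundedness and compact operators *)

Section TotallyBounded.
Variables (K : numFieldType).

Definition totally_bounded (H : normedModType K) (A : set H) : Prop :=
  forall e : K, 0 < e -> exists s : seq H,
    forall x, A x -> exists2 y, y \in s & `|x - y| < e.

Lemma totally_bounded_approx (H : normedModType K) (A : set H) :
  (forall e : K, 0 < e -> exists2 B : set H, totally_bounded B &
     forall x, A x -> exists2 y, B y & `|x - y| < e) ->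
  totally_bounded A.
Proof.
move=> AB e e0; have e20 : 0 < e / 2 by rewrite divr_gt0.
have [B /(_ _ e20)[s Bs] Bapprox] := AB _ e20.
exists s => x /Bapprox[y /Bs[z zs yz] xy]; exists z => //.
rewrite -(subrK y x) -addrA (le_lt_trans (ler_normD _ _))//.
by rewrite (splitr e) ltrD.
Qed.

Lemma totally_boundedS (H : normedModType K) (A B : set H) :
  A `<=` B -> totally_bounded B -> totally_bounded A.
Proof. by move=> AB tB e /tB[s sP]; exists s => x /AB/sP. Qed.

Lemma totally_boundedD (H : normedModType K) (A B : set H) :
  totally_bounded A -> totally_bounded B ->
  totally_bounded [set x + y | x in A & y in B].
Proof.
move=> tA tB e e0; have e20 : 0 < e / 2 by rewrite divr_gt0.
have [s sP] := tA _ e20; have [t tP] := tB _ e20.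
exists [seq x + y | x <- s, y <- t].
move=> _ [x /sP[x' x's xx'] [y /tP[y' y't yy'] <-]].
exists (x' + y'); first exact: allpairs_f.
by rewrite opprD addrACA (le_lt_trans (ler_normD _ _))// (splitr e) ltrD.
Qed.

Lemma totally_bounded_image (H : normedModType K) (A : set H)
    (T : {linear H -> H}) :
  bounded_op T -> totally_bounded A -> totally_bounded (T @` A).
Proof.
move=> /bounded_opP[C C0 CT] tA e e0.
have [|s sP] := tA (e / C); first by rewrite divr_gt0.
exists [seq T y | y <- s] => _ [x /sP[y ys xy] <-]; exists (T y).
  exact: map_f.
by rewrite -linearB (le_lt_trans (CT _))// mulrC -ltr_pdivlMr.
Qed.

Lemma totally_bounded_norm (H : normedModType K) (A : set H) :
  totally_bounded A -> exists C : K, forall x, A x -> `|x| <= C.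
Proof.
move=> /(_ 1 ltr01)[s sP]; exists (1 + \sum_(y <- s) `|y|) => x /sP[y ys xy].
rewrite -(subrK y x) (le_trans (ler_normD _ _))// lerD ?(ltW xy)//.
by rewrite (big_rem y)//= lerDl sumr_ge0.
Qed.

Lemma totally_bounded_closure (H : normedModType K) (A : set H) :
  totally_bounded A -> totally_bounded (closure A).
Proof.
move=> tA; apply: totally_bounded_approx => e e0; exists A => // x.
move=> /(_ (ball x e))/(_ (nbhsx_ballx _ _ e0))[y [Ay]].
by rewrite -ball_normE; exists y.
Qed.

Lemma ultra_net (H : normedModType K) (F : set_system H) (A : set H) (e : K)
    (s : seq H) : UltraFilter F -> F A ->
  (forall x, A x -> exists2 y, y \in s & `|x - y| < e) ->
  exists y, F (ball y e).
Proof.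
move=> FU; elim: s A => [|y s IH] A FA As.
  have A0 : A = set0 by apply/seteqP; split=> // x /As[].
  by exfalso; apply: (@filter_not_empty _ F); rewrite -A0.
have [Fy|Fy] := in_ultra_setVsetC (ball y e) FU; first by exists y.
apply: (IH _ (filterI FA Fy)) => x [Ax nyx].
have [z] := As _ Ax; rewrite inE => /orP[/eqP->|]; last by exists z.
by move=> xy; exfalso; apply: nyx; rewrite -ball_normE /ball_/= distrC.
Qed.

(** For the converse, an ultrafilter containing a totally bounded set contains
    balls of every radius, so it is Cauchy. *)
Lemma compact_closureP (H : completeNormedModType K) (A : set H) :
  compact (closure A) <-> totally_bounded A.
Proof.
split.
  rewrite compact_cover => cA e e0.
  have [x _|x cAx|D' _ cov] := cA H setT (fun y => ball y e).
  - exact: ball_open.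
  - by exists x => //; exact: ballxx.
  exists (finmap.enum_fset D') => x /subset_closure/cov[y /= yD'].
  by rewrite -ball_normE /ball_/= distrC; exists y.
move=> /totally_bounded_closure tA; rewrite compact_ultra => F FU FA.
have cF : cauchy F.
  by apply: cauchy_exP => e /tA[s sP]; exact: ultra_net FA sP.
have /cvg_ex[/= l Fl] : cvg F by exact: cauchy_cvg.
exists l; split => //; apply: closed_closure => B Bl.
exact: (@filter_ex _ F _ _ (filterI FA (Fl _ Bl))).
Qed.

Lemma compact_opP (H : completeNormedModType K) (T : {linear H -> H}) :
  compact_op T <-> totally_bounded (T @` [set x : H | `|x| <= 1]).
Proof. exact: compact_closureP. Qed.

Lemma compact_op_bounded (H : completeNormedModType K) (T : {linear H -> H}) :
  compact_op T -> bounded_op T.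
Proof.
move=> /compact_opP/totally_bounded_norm[C TC]; exists C.
by apply: homogeneous_le => x x1; apply: TC; exists x.
Qed.

End TotallyBounded.

Section CompactOperators.
Variables (K : numFieldType) (H : completeNormedModType K).
Implicit Types T U : {linear H -> H}.

Lemma compact_op0 : compact_op (\0 : {linear H -> H}).
Proof.
apply/compact_opP => e e0; exists [:: 0] => _ [x _ <-].
by exists 0; rewrite ?mem_head// subr0 normr0.
Qed.

Lemma compact_op_comp T U : compact_op T -> compact_op U -> compact_op (U \o T).
Proof.
move=> /compact_opP cT /compact_op_bounded bU; apply/compact_opP.
by have := totally_bounded_image bU cT; rewrite image_comp.
Qed.

Lemma compact_op_lin (a : K) T U :
  compact_op T -> compact_op U -> compact_op (a \*: T \+ U).
Proof.
move=> /compact_opP cT /compact_opP cU; apply/compact_opP.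
have ba : bounded_op (a \*: idfun : {linear H -> H}).
  by exists `|a| => x; rewrite /= normrZ.
apply: totally_boundedS (totally_boundedD (totally_bounded_image ba cT) cU).
move=> _ [x x1 <-]; exists (a *: T x); first by exists (T x) => //; exists x.
by exists (U x) => //; exists x.
Qed.

Lemma compact_op_limit T :
  (forall e : K, 0 < e -> exists2 U : {linear H -> H}, compact_op U &
     forall x, `|x| <= 1 -> `|T x - U x| < e) -> compact_op T.
Proof.
move=> TU; apply/compact_opP/totally_bounded_approx => e /TU[U cU UT].
exists (U @` [set x : H | `|x| <= 1]); first exact/compact_opP.
by move=> _ [x x1 <-]; exists (U x); [exists x|exact: UT].
Qed.

End CompactOperators.

(** * Orthogonal projections onto finite-dimensional subspaces *)

Section Projection.
Variables (R : realType) (k : scalar_kind).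
Local Notation K := (scalars R k).
Variables (H : normedModType K) (dot : {dot H for @scalar_conj R k}).
Hypothesis dotE : forall x : H, dot x x = `|x| ^+ 2.
Implicit Types (s : seq H) (x y z v : H) (T : {linear H -> H}).

Let dotBl x y z : dot (x - y) z = dot x z - dot y z.
Proof. exact: linearBl. Qed.
Let dotD x y z : dot (x + y) z = dot x z + dot y z.
Proof. exact: linearDl. Qed.
Let dotDr x y z : dot z (x + y) = dot z x + dot z y.
Proof. exact: linearDr. Qed.
Let dotZl a x y : dot (a *: x) y = a * dot x y.
Proof. exact: linearZl_LR. Qed.

Lemma dotC0 x y : dot x y = 0 -> dot y x = 0.
Proof.
have -> : dot y x = (-1) ^+ false * scalar_conj (dot x y).
  exact: hermitian_subproof.
move=> ->; rewrite expr0 mul1r.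
by case: (k) => //=; exact: conjc0.
Qed.

Lemma pythagoras x y : dot x y = 0 -> `|x + y| ^+ 2 = `|x| ^+ 2 + `|y| ^+ 2.
Proof.
move=> xy; rewrite -!dotE dotDr !dotD xy (dotC0 xy).
by rewrite addr0 add0r.
Qed.

Lemma dotZ0 a x y : dot x y = 0 -> dot (a *: x) y = 0.
Proof. by move=> xy; rewrite dotZl xy mulr0. Qed.

Lemma orth_norm_le x y : dot x y = 0 -> `|x| <= `|x + y|.
Proof.
move=> /pythagoras xy; rewrite -(@ler_pXn2r _ 2)// ?nnegrE// xy.
by rewrite lerDl exprn_ge0.
Qed.

Definition orth_projection s (P : H -> H) : Prop :=
  forall x, lspan s (P x) /\ forall v, lspan s v -> dot (x - P x) v = 0.

(** Gram-Schmidt without normalisation: adjoining y adds the projection onto the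
    line of z = y - P y, whose formula is also right when z = 0. *)
Lemma orth_projection_exists s :
  exists P : {linear H -> H}, orth_projection s P.
Proof.
elim: s => [|y s [P Pproj]].
  exists \0 => x; split=> // v ->; exact: linear0r.
pose z := y - P y.
have Pz v : lspan s v -> dot z v = 0 by exact: (Pproj y).2.
have linQ : linear (fun x => P x + (dot x z / dot z z) *: z).
  move=> a u v; rewrite linearP dotD dotZl mulrDl scalerDl -mulrA -scalerA.
  by rewrite (scalerDr a (P u)) addrACA.
exists (linear_of linQ) => x /=; set c := dot x z / dot z z; split.
  exists c; rewrite scalerBr addrA addrAC addrK.
  by apply: lspanB; [exact: (Pproj x).1|exact/lspanZ/(Pproj y).1].
have orthz : dot (x - (P x + c *: z)) z = 0.
  have [z0|z0] := eqVneq z 0; first by rewrite {2}z0; exact: linear0r.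
  rewrite opprD addrA !dotBl dotZl divfK ?dotE ?expf_neq0 ?normr_eq0//.
  by rewrite (dotC0 (Pz _ (Pproj x).1)) subr0 subrr.
have orths v : lspan s v -> dot (x - (P x + c *: z)) v = 0.
  move=> sv; rewrite opprD addrA dotBl dotZl (Pproj x).2// (Pz _ sv).
  by rewrite mulr0 subr0.
move=> v [d svd]; rewrite -(subrK (d *: y) v) dotDr orths// add0r.
apply: dotC0; rewrite dotZl dotC0 ?mulr0//.
by rewrite -(subrK (P y) y) dotDr orthz add0r; exact/orths/(Pproj y).1.
Qed.

Lemma orth_projection_le s P x : orth_projection s P -> `|P x| <= `|x|.
Proof.
move=> /(_ x)[sPx xP]; have := orth_norm_le (dotC0 (xP _ sPx)).
by rewrite addrC subrK.
Qed.

Lemma orth_projection_best s P x v : orth_projection s P -> lspan s v ->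
  `|x - P x| <= `|x - v|.
Proof.
move=> /(_ x)[sPx xP] sv; have := orth_norm_le (xP _ (lspanB sPx sv)).
by rewrite addrA subrK.
Qed.

Lemma exists_orth_unit s : ~ finite_dim (xpredT : H -> bool) ->
  exists2 u, `|u| = 1 & forall v, lspan s v -> dot u v = 0.
Proof.
move=> infH; have [P Pproj] := orth_projection_exists s.
have [x xP] : exists x, x - P x != 0.
  apply: contra_notP infH => nx; apply/finite_dimP; exists s => x.
  split=> // _; have -> : x = P x; last exact: (Pproj x).1.
  by apply/eqP; rewrite -subr_eq0; apply/negPn/negP => xP; apply: nx; exists x.
exists (`|x - P x|^-1 *: (x - P x)).
  by rewrite normrZ normfV normr_id mulVf// normr_eq0.
by move=> v sv; rewrite dotZl (Pproj x).2// mulr0.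
Qed.

(** A vector of the span of y :: s splits orthogonally into a vector of the span
    of s and a multiple of y - P y, and neither part exceeds it in norm. *)
Lemma lspan_ball_totally_bounded s (M : K) :
  totally_bounded [set x | lspan s x /\ `|x| <= M].
Proof.
elim: s => [|y s IH].
  move=> e e0; exists [:: 0] => x [-> _].
  by exists 0; rewrite ?mem_head ?subr0 ?normr0.
have [P Pproj] := orth_projection_exists s; pose z := y - P y.
have decomp x : lspan (y :: s) x -> exists c, lspan s (x - c *: z).
  move=> [c sxc]; exists c; rewrite scalerBr opprB addrCA addrC.
  by apply: lspanD => //; exact/lspanZ/(Pproj y).1.
have [z0|z0] := eqVneq z 0.
  apply: totally_boundedS IH => x [/decomp[c]].
  by rewrite z0 scaler0 subr0.
have nz0 : 0 < `|z| by rewrite normr_gt0.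
pose B := [set c *: z | c in [set c : K | `|c| <= M / `|z|]].
have tB : totally_bounded B.
  move=> e e0; have [|t tP] := @scalar_net R k (M / `|z|) (e / `|z|).
    by rewrite divr_gt0.
  exists [seq c *: z | c <- t] => _ [c /tP[d dt cd] <-].
  exists (d *: z); first exact: map_f.
  by rewrite -scalerBl normrZ -ltr_pdivlMr.
apply: totally_boundedS (totally_boundedD IH tB) => x [/decomp[c sw] xM].
have orthzw : dot z (x - c *: z) = 0 := (Pproj y).2 _ sw.
have orthwz : dot (x - c *: z) (c *: z) = 0.
  by apply: dotC0; rewrite dotZl orthzw mulr0.
exists (x - c *: z).
  split => //; rewrite (le_trans _ xM)//.
  by rewrite (le_trans (orth_norm_le orthwz)) ?subrK.
exists (c *: z); last by rewrite subrK.
exists c => //=; rewrite ler_pdivlMr// -normrZ (le_trans _ xM)//.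
by rewrite (le_trans (orth_norm_le (dotC0 orthwz)))// addrC subrK.
Qed.

End Projection.

(** * Compact operators on a Hilbert space *)

Section HilbertCompact.
Variables (R : realType) (k : scalar_kind).
Local Notation K := (scalars R k).
Variables (H : completeNormedModType K) (dot : {dot H for @scalar_conj R k}).
Hypothesis dotE : forall x : H, dot x x = `|x| ^+ 2.
Implicit Types T U : {linear H -> H}.

Lemma finite_rank_compact T : finite_rank T -> compact_op T.
Proof.
move=> [/bounded_opP[C C0 CT] /finite_dim_rangeP[s sT]]; apply/compact_opP.
apply: totally_boundedS (lspan_ball_totally_bounded dotE s C) => _ [x /= x1 <-].
by split => //; rewrite (le_trans (CT x))// ger_pMr.
Qed.

(** Compose T with the orthogonal projection onto the span of an e-net of the
    image of the unit ball. *)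
Lemma compact_finite_rank_approx T : compact_op T -> forall e : K, 0 < e ->
  exists2 U : {linear H -> H}, finite_rank U &
    forall x, `|x| <= 1 -> `|T x - U x| <= e.
Proof.
move=> cT e e0; have /compact_opP/(_ _ e0)[s sT] := cT.
have [C C0 CT] := bounded_opP (compact_op_bounded cT).
have [P Pproj] := orth_projection_exists dotE s; exists (P \o T).
  split.
    exists C => x; rewrite (le_trans _ (CT x))//.
    exact: (orth_projection_le dotE _ Pproj).
  by apply: (@finite_rank_sub _ _ s) => x; exact: (Pproj _).1.
move=> x x1; have [|y ys Txy] := sT (T x); first by exists x.
rewrite (le_trans _ (ltW Txy))// (orth_projection_best dotE _ Pproj)//.
exact: lspan_mem.
Qed.

Hypothesis infH : ~ finite_dim (xpredT : H -> bool).

(** Up to r/4 the image of the ball of radius C lies in a finite-dimensional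
    subspace; moving x by r in a direction orthogonal to that subspace and to x
    brings it to distance at least r from the subspace. *)
Lemma compact_op_avoid T (x : H) (r C : K) : compact_op T -> 0 < r -> 0 < C ->
  exists2 x', `|x' - x| = r &
    forall w, `|w| <= C -> r <= `|x' - T w| + r / 4.
Proof.
move=> cT r0 C0; pose e := r / 4 / C.
have e0 : 0 < e by rewrite !divr_gt0.
have [U [_ /finite_dim_rangeP[s sU]] TU] := compact_finite_rank_approx cT e0.
have [u u1 uorth] := exists_orth_unit dotE (x :: s) infH.
exists (x + r *: u); first by rewrite addrC addKr normrZ u1 mulr1 gtr0_norm.
move=> w wC; have rU : r <= `|x + r *: u - U w|.
  rewrite -[x + _]addrC -addrA -[leLHS]mulr1 -u1 -{1}[r](gtr0_norm r0) -normrZ.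
  apply: (orth_norm_le dotE); rewrite (dotZ0 _ (uorth _ _))//.
  exists 1; rewrite scale1r addrAC subrr add0r -scaleN1r; exact: lspanZ.
have TwU : `|T w - U w| <= r / 4.
  have /(_ w) := @homogeneous_le _ _ (T \- U) e TU.
  move=> /le_trans; apply; rewrite /e -mulrA ger_pMr ?divr_gt0//.
  by rewrite ler_pdivrMl// mulr1.
rewrite (le_trans rU)//.
have -> : x + r *: u - U w = (x + r *: u - T w) + (T w - U w).
  by rewrite addrA subrK.
by rewrite (le_trans (ler_normD _ _))// lerD.
Qed.

(** Starting from 0, step n moves by r n = 4^-n, away from the image of the ball
    of radius n + 1.  All later steps together move by at most
    2 * r n.+1 = r n / 2, so the limit still avoids each of these images. *)
Lemma compact_op_not_surjective T :
  compact_op T -> exists y, forall x, T x <> y.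
Proof.
move=> cT; pose r n : K := 4^-1 ^+ n.
have r0 n : 0 < r n by rewrite exprn_gt0.
have rS n : 2 * r n.+1 = r n / 2.
  by rewrite /r exprS; field.
have rle n : r n <= n.+1%:R^-1.
  rewrite /r exprVn lef_pV2 ?posrE ?exprn_gt0 ?ltr0Sn//.
  by rewrite -natrX ler_nat ltn_expl.
have stepP n x : exists x', `|x' - x| = r n /\
    forall w, `|w| <= n.+1%:R -> r n <= `|x' - T w| + r n / 4.
  by have [x' ? ?] := compact_op_avoid x cT (r0 n) (ltr0Sn K n); exists x'.
have [f fP] := choice (fun nx => stepP nx.1 nx.2).
pose a := fix a n := if n is m.+1 then f (m, a m) else 0.
have tail p n : `|a (n + p)%N - a n| <= 2 * r n.
  elim: p n => [|p IH] n; first by rewrite addn0 subrr normr0 mulr_ge0 ?ltW.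
  rewrite addnS -addSn -(subrK (a n.+1) (a (n.+1 + p)%N)) -addrA.
  rewrite (le_trans (ler_normD _ _))// (le_trans (lerD (IH n.+1) (lexx _)))//.
  rewrite [a n.+1]/= (fP (n, a n)).1 /= rS mulr_natl mulr2n lerD2r.
  by rewrite ger_pMr// invf_le1// (ler1n K 2).
have ca : cauchy (a @ \oo).
  apply: cauchy_exP => e e0.
  have [|n ne] := @scalar_invn R k (e / 2); first by rewrite divr_gt0.
  exists (a n); exists n => // m /= nm; rewrite -ball_normE /ball_/= distrC.
  rewrite -(subnKC nm) (le_lt_trans (tail _ _))// mulrC -ltr_pdivlMr//.
  exact: le_lt_trans (rle n) ne.
have /cvg_ex[/= y ay] : cvg (a @ \oo) by exact: cauchy_cvg.
exists y => x Tx; have [n xn] := scalar_archi (normr_ge0 x).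
have r40 : 0 < r n / 4 by rewrite divr_gt0.
have /cvgrPdist_lt/(_ _ r40)[N _ aN] := ay.
have := aN (n.+1 + N)%N (leq_addl _ _).
have /= := (fP (n, a n)).2 x; rewrite Tx.
have xn1 : `|x| <= n.+1%:R by rewrite (le_trans xn)// ler_nat.
move=> /(_ xn1); rewrite -[f _]/(a n.+1) => rn ym.
suff : r n < r n by rewrite ltxx.
apply: (le_lt_trans rn).
(* The summands bound the tail of the series, the distance from a far enough
   term to the limit, and the slack of [compact_op_avoid]. *)
have {2}-> : r n = r n / 2 + r n / 4 + r n / 4.
  by field.
rewrite ltrD2r -(subrK (a (n.+1 + N)%N) (a n.+1)) -addrA.
rewrite (le_lt_trans (ler_normD _ _))// distrC ler_ltD//.
  by rewrite -rS.
by rewrite distrC.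
Qed.

End HilbertCompact.

(** * Normed algebras of bounded operators *)

Section OperatorNorm.
Variables (R : realType) (k : scalar_kind).
Local Notation K := (scalars R k).
Variable H : normedModType K.
Implicit Types (T : {linear H -> H}) (C : K).

Lemma opnorm_supremums T : bounded_op T ->
  supremums [set `|T x| | x in [set x : H | `|x| <= 1]] (opnorm T).
Proof.
move=> /bounded_opP[C C0 CT]; set A := [set _ | _ in _].
have A0 : A !=set0 by exists `|T 0|, 0; rewrite //= normr0.
have [||s As] := @scalar_supremums R k A A0.
- by move=> _ [x _ <-].
- by exists C => _ [x x1 <-]; rewrite (le_trans (CT x))// ger_pMr.
rewrite /opnorm /supremum -/A ifF; first exact: xgetI As.
by apply/negbTE/set0P.
Qed.

Lemma opnorm_ge0 T : bounded_op T -> 0 <= opnorm T.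
Proof.
move=> /opnorm_supremums[ubT _]; rewrite (le_trans (normr_ge0 (T 0)))// ubT//.
by exists 0; rewrite //= normr0.
Qed.

Lemma ler_opnorm T x : bounded_op T -> `|T x| <= opnorm T * `|x|.
Proof.
move=> /opnorm_supremums[ubT _]; apply: homogeneous_le => {}x x1.
by apply: ubT; exists x.
Qed.

Lemma opnorm_le T C : (forall x, `|x| <= 1 -> `|T x| <= C) -> opnorm T <= C.
Proof.
move=> TC; have bT : bounded_op T by exists C; exact: homogeneous_le.
have [_] := opnorm_supremums bT; apply => _ [x x1 <-]; exact: TC.
Qed.

Lemma opnorm_ball T x : bounded_op T -> `|x| <= 1 -> `|T x| <= opnorm T.
Proof.
by move=> /opnorm_supremums[ubT _] x1; apply: ubT; exists x.
Qed.

End OperatorNorm.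

Section OperatorAlgebra.
Variables (R : realType) (k : scalar_kind).
Local Notation K := (scalars R k).
Variable H : normedModType K.
Implicit Types T U : {linear H -> H}.

Record operator_subalgebra := OperatorSubalgebra {
  opsub_pred : {linear H -> H} -> Prop;
  opsub0 : opsub_pred \0;
  opsub_lin : forall (c : K) T U,
    opsub_pred T -> opsub_pred U -> opsub_pred (c \*: T \+ U);
  opsub_comp : forall T U, opsub_pred T -> opsub_pred U -> opsub_pred (U \o T);
  opsub_bounded : forall T, opsub_pred T -> bounded_op T
}.

Variable S : operator_subalgebra.

(** The operators of S as plain functions: the type H -> H has a module
    structure, which the carrier of the algebra can inherit. *)
Definition underlying : {pred (H -> H)} :=
  mem [set f : H -> H | exists2 T, opsub_pred S T & f = T].

Fact underlying_closed : submod_closed underlying.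
Proof.
split; first by apply/mem_set; exists \0; first exact: opsub0.
move=> c f g /set_mem[T ST ->] /set_mem[U SU ->]; apply/mem_set.
by exists (c \*: T \+ U); first exact: opsub_lin.
Qed.

HB.instance Definition _ :=
  GRing.isSubmodClosed.Build K (H -> H) underlying underlying_closed.

Record operator := Operator {
  op_fun :> H -> H;
  op_memP : op_fun \in underlying
}.

HB.instance Definition _ := [isSub for op_fun].
HB.instance Definition _ := [Choice of operator by <:].
HB.instance Definition _ := [SubChoice_isSubLmodule of operator by <:].

Fact op_fun_linear (a : operator) : linear a.
Proof. by have /set_mem[T _ ->] := op_memP a; exact: linearP. Qed.

Definition op_linear (a : operator) : {linear H -> H} :=
  linear_of (op_fun_linear a).

Lemma op_mem (a : operator) : opsub_pred S (op_linear a).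
Proof.
have /set_mem[T ST aT] := op_memP a.
by rewrite (linear_ext (T := op_linear a) aT).
Qed.

Lemma exists_operator T : opsub_pred S T ->
  exists a : operator, op_linear a = T.
Proof.
move=> ST; have Tmem : (T : H -> H) \in underlying by apply/mem_set; exists T.
by exists (Operator Tmem); exact: linear_ext.
Qed.

Lemma op_bounded (a : operator) : bounded_op a.
Proof. exact: opsub_bounded (op_mem a). Qed.

Let opnorm_opball (a : operator) x : `|x| <= 1 -> `|a x| <= opnorm a.
Proof. exact: (@opnorm_ball _ _ _ (op_linear a) x (op_bounded a)). Qed.

Fact op_normD (a b : operator) : opnorm (a + b) <= opnorm a + opnorm b.
Proof.
apply: (@opnorm_le _ _ _ (op_linear (a + b))) => x x1.
by rewrite (le_trans (ler_normD _ _))// lerD// opnorm_opball.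
Qed.

Fact op_normZ (c : K) (a : operator) : opnorm (c *: a) = `|c| * opnorm a.
Proof.
apply/le_anti/andP; split.
  apply: (@opnorm_le _ _ _ (op_linear (c *: a))) => x x1.
  by rewrite [leLHS]normrZ ler_wpM2l// opnorm_opball.
have [->|c0] := eqVneq c 0.
  rewrite normr0 mul0r; apply: (@opnorm_ge0 _ _ _ (op_linear (0 *: a))).
  exact: op_bounded.
rewrite mulrC -ler_pdivlMr ?normr_gt0//.
apply: (@opnorm_le _ _ _ (op_linear a)) => x x1.
rewrite ler_pdivlMr ?normr_gt0// mulrC -[leLHS]normrZ.
exact: (opnorm_opball (c *: a)).
Qed.

Fact op_norm_eq0 (a : operator) : opnorm a = 0 -> a = 0.
Proof.
move=> a0; apply/val_inj/funext => x /=.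
have := @ler_opnorm _ _ _ (op_linear a) x (op_bounded a).
by rewrite a0 mul0r normr_le0 => /eqP.
Qed.

HB.instance Definition _ :=
  Lmodule_isNormed.Build K operator op_normD op_normZ op_norm_eq0.

Fact op_mul_subproof (a b : operator) : (b \o a : H -> H) \in underlying.
Proof.
apply/mem_set; exists (op_linear b \o op_linear a) => //.
by apply: opsub_comp; exact: op_mem.
Qed.

Definition op_mul (a b : operator) : operator := Operator (op_mul_subproof a b).

Fact op_mulA : associative op_mul.
Proof. by move=> a b c; apply/val_inj. Qed.

Fact op_mulDl : left_distributive op_mul +%R.
Proof.
move=> a b c; apply/val_inj/funext => x /=.
exact: (linearD (op_linear c)).
Qed.

Fact op_mulDr : right_distributive op_mul +%R.
Proof. by move=> a b c; apply/val_inj. Qed.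

Fact op_scaleAl (c : K) a b : op_mul (c *: a) b = c *: op_mul a b.
Proof. by apply/val_inj/funext => x /=; exact: (linearZ_LR (op_linear b)). Qed.

Fact op_scaleAr (c : K) a b : op_mul a (c *: b) = c *: op_mul a b.
Proof. exact/val_inj. Qed.

Fact op_normM a b : `|op_mul a b| <= `|a| * `|b|.
Proof.
rewrite mulrC; apply: (@opnorm_le _ _ _ (op_linear (op_mul a b))) => x x1 /=.
have b0 : 0 <= `|b| by [].
rewrite (le_trans (@ler_opnorm _ _ _ (op_linear b) (a x) (op_bounded b)))//.
by rewrite ler_wpM2l// opnorm_opball.
Qed.

Definition op_algebra : normedAlgebra K :=
  NormedAlgebra op_mulA op_mulDl op_mulDr op_scaleAl op_scaleAr op_normM.

Section Represented.
Variables (X : Type) (rep : {linear H -> H} -> X -> Prop) (C : set X).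
Variable elt : operator -> X.
Hypothesis eltE : range elt = C.
Hypothesis rep_elt : forall T a, rep T (elt a) <-> (T : H -> H) = a.

(** Objects represented by exactly one operator inherit the algebra of the
    operators. *)
Definition op_operator_algebra : operator_algebra rep C.
Proof.
apply: (@OperatorAlgebra K H X rep C op_algebra elt).
- move=> a b ab; apply/val_inj => /=.
  have /(rep_elt (op_linear a)) := erefl (a : H -> H).
  by rewrite ab => /rep_elt.
- exact: eltE.
- by move=> a; exists (op_linear a); apply/rep_elt.
- by move=> T1 T2 a b /rep_elt Ta /rep_elt Tb; apply/rep_elt; rewrite /= Ta Tb.
- by move=> c T a /rep_elt Ta; apply/rep_elt; rewrite /= Ta.
- by move=> T1 T2 a b /rep_elt Ta /rep_elt Tb; apply/rep_elt; rewrite /= Ta Tb.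
- by move=> T a /rep_elt ->.
Defined.

End Represented.

End OperatorAlgebra.

Section Instances.
Variables (R : realType) (k : scalar_kind).
Local Notation K := (scalars R k).

Definition finite_rank_ops (H : normedModType K) : operator_subalgebra H :=
  OperatorSubalgebra (finite_rank0 H) (@finite_rank_lin _ H)
    (@finite_rank_comp _ H) (fun T fT => fT.1).

Variable H : completeNormedModType K.

Definition compact_ops : operator_subalgebra H :=
  OperatorSubalgebra (@compact_op0 _ H) (@compact_op_lin _ H)
    (@compact_op_comp _ H) (@compact_op_bounded _ H).

(** The pointwise limit of a Cauchy filter is also its limit uniformly on the
    unit ball, hence compact. *)
Lemma compact_ops_banach : banach (op_algebra compact_ops).
Proof.
move=> F PF cF.
have Fnear (e : K) : 0 < e -> exists2 Q : set (operator compact_ops), F Q &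
    forall a b, Q a -> Q b -> `|a - b| < e.
  move=> e0; have e20 : 0 < e / 2 by rewrite divr_gt0.
  have /cauchyP/(_ _ e20)[c Fc] := cF.
  exists (ball c (e / 2)) => // a b; rewrite -ball_normE /ball_/= => ca cb.
  rewrite -(subrK c a) -addrA (le_lt_trans (ler_normD _ _))//.
  by rewrite (splitr e) ltrD// distrC.
have dist_le (a b : operator compact_ops) (x : H) :
    `|a x - b x| <= `|a - b| * `|x|.
  exact: (@ler_opnorm _ _ _ (op_linear (a - b)) x (op_bounded _)).
have evF (x : H) : ProperFilter ((fun a : operator compact_ops => a x) @ F).
  exact: (@fmap_proper_filter _ _ _ F PF).
have limF x : exists l : H, (fun a : operator compact_ops => a x) @ F --> l.
  apply/cvg_ex/(@cauchy_cvg _ _ (evF x))/(@cauchy_exP _ _ _ (evF x)) => e e0.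
  have e10 : 0 < e / (`|x| + 1) by rewrite divr_gt0// ltr_wpDl.
  have [Q FQ Qe] := Fnear _ e10; have [a Qa] := filter_ex FQ.
  exists (a x).
  change (F [set b : operator compact_ops | ball (a x) e (b x)]).
  apply: filterS FQ => b Qb; rewrite -ball_normE /ball_/=.
  rewrite (le_lt_trans (dist_le a b x))//.
  rewrite (@le_lt_trans _ _ (`|a - b| * (`|x| + 1)))// ?ler_wpM2l ?lerDl//.
  by rewrite -ltr_pdivlMr ?ltr_wpDl// Qe.
have [g gP] := choice limF.
have lin_g : linear g.
  move=> c x y; apply: (cvg_unique _ (gP (c *: x + y))) => //.
  have -> : (fun a : operator compact_ops => a (c *: x + y)) =
      (c \*: (fun a : operator compact_ops => a x)) \+
      (fun a : operator compact_ops => a y).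
    by apply/funext => a; exact: (linearP (op_linear a)).
  exact: cvgD (cvgZr (gP x)) (gP y).
have near_g (e : K) : 0 < e -> exists2 Q : set (operator compact_ops), F Q &
    forall a, Q a -> forall x, `|x| <= 1 -> `|g x - a x| < e.
  move=> e0; have e20 : 0 < e / 2 by rewrite divr_gt0.
  have [Q FQ Qe] := Fnear _ e20; exists Q => // a Qa x x1.
  have /cvgrPdist_lt/(_ _ e20) Fx := gP x.
  have [b [Qb gb]] := filter_ex (filterI FQ Fx).
  rewrite -(subrK (b x) (g x)) -addrA (le_lt_trans (ler_normD _ _))//.
  rewrite (splitr e) ltr_leD// (le_trans (dist_le b a x))//.
  by rewrite (le_trans _ (ltW (Qe b a Qb Qa)))// ler_piMr.
have cg : compact_op (linear_of lin_g).
  apply: compact_op_limit => e /near_g[Q FQ Qe].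
  have [a Qa] := filter_ex FQ; exists (op_linear a); last exact: Qe.
  exact: (op_mem a).
have [G GE] := @exists_operator _ _ _ compact_ops _ cg.
apply/cvg_ex; exists G; apply/cvgrPdist_lt => e e0.
have [Q FQ Qe] := near_g (e / 2) (divr_gt0 e0 (ltr0Sn _ 1)).
apply: filterS FQ => a Qa.
have e2e : e / 2 < e by rewrite ltr_pdivrMr// ltr_pMr ?ltr1n.
rewrite (le_lt_trans _ e2e)//.
apply: (@opnorm_le _ _ _ (op_linear (G - a))) => x x1.
have Gx : G x = g x by rewrite -[G x]/(op_linear G x) GE.
by have := Qe a Qa x x1; rewrite -Gx; exact: ltW.
Qed.

End Instances.

(** * Cones of restrictions of an operator *)

Section Cones.
Variables (K : numFieldType) (H : normedModType K).
Implicit Types T U : {linear H -> H}.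

Lemma cone_eq P (c d : cone (H := H) P) :
  (vertex c : H -> bool) = vertex d ->
  (forall (M : Defs.subspace H) (hM : P M) (x : vec M),
     vec_val (component c hM x) = vec_val (component d hM x)) -> c = d.
Proof.
case: c d => [[N N0] hN f fi] [[N' N0'] hN' g gi] /= eN; subst N'.
rewrite (Prop_irrelevance N0 N0') in hN f fi *.
move=> fg; have {}fg : f = g.
  apply: functional_extensionality_dep => M.
  apply: functional_extensionality_dep => hM.
  by apply/linear_ext/funext => x; exact/val_inj/fg.
by subst g; rewrite (Prop_irrelevance hN hN') (Prop_irrelevance fi gi).
Qed.

(** When the subspaces satisfying P cover H, the restrictions of an operator to
    them determine it. *)
Lemma represents_range_cone (P : (H -> bool) -> Prop) T U
    (hU : P (range_subspace U)) :
  (forall x, exists2 M : Defs.subspace H, P M & x \in M) -> bounded_op U ->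
  represents T (range_cone hU) <-> (T : H -> H) = U.
Proof.
move=> coverP bU; split=> [[_ [hT UT]]|/linear_ext->].
  apply/funext => x; have [M hM Mx] := coverP x.
  by have /(congr1 (fun c => vec_val (component c hM (Vec Mx)))) := UT.
by split => //; exists hU.
Qed.

Lemma represents_inj (P : (H -> bool) -> Prop) T U (c : cone P) :
  (forall x, exists2 M : Defs.subspace H, P M & x \in M) ->
  represents T c -> represents U c -> T = U.
Proof.
move=> coverP rT [bU [hU cU]]; apply: linear_ext.
by move: rT; rewrite cU => /(represents_range_cone _ _ coverP bU).
Qed.

End Cones.

Section BoundedNormalCones.
Variables (K : numFieldType) (H : normedModType K).
Implicit Types (x y : H) (T : {linear H -> H}) (c : cone (@finite_dim K H)).

Lemma finite_dim_cover x : exists2 M : Defs.subspace H, finite_dim M & x \in M.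
Proof.
exists (span_subspace [:: x]); first exact: finite_dim_span.
exact/mem_span_subspace/lspan_mem/mem_head.
Qed.

Let line x : Defs.subspace H := span_subspace [:: x].
Let mem_line x : x \in line x.
Proof. exact/mem_span_subspace/lspan_mem/mem_head. Qed.

(** The operator defined by a cone in F(H): its value at x is read on the line
    of x, and compatibility with inclusions makes any finite-dimensional
    subspace that contains x give the same value. *)
Definition glue c x : H :=
  vec_val (component c (finite_dim_span [:: x]) (Vec (mem_line x))).

Lemma glueE c (M : Defs.subspace H) (hM : finite_dim M) (x : vec M) :
  glue c (vec_val x) = vec_val (component c hM x).
Proof.
have lineM : {subset line (vec_val x) <= M}.
  move=> y /mem_span_subspace[d /eqP]; rewrite subr_eq0 => /eqP ->.
  exact/rpredZ/vec_valP.
rewrite /glue -(component_incl _ _ hM lineM).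
by congr (vec_val (component c hM _)); exact/val_inj.
Qed.

Lemma glue_linear c : linear (glue c).
Proof.
move=> a x y; pose M := span_subspace [:: x; y].
have hM : finite_dim M by exact: finite_dim_span.
have Mx : x \in M by apply/mem_span_subspace/lspan_mem; rewrite !inE eqxx.
have My : y \in M by apply/mem_span_subspace/lspan_mem; rewrite !inE eqxx orbT.
rewrite (glueE c hM (Vec Mx)) (glueE c hM (Vec My)).
rewrite (glueE c hM (a *: Vec Mx + Vec My)).
by rewrite linearP.
Qed.

(** Normality makes the vertex equal to the range of the glued operator.
    Conversely, the cone of T is normal because T restricts to an isomorphism
    from the span of preimages of a basis of its range. *)
Lemma bounded_normal_coneP c :
  BF H c <-> exists2 T, finite_rank T & represents T c.
Proof.
split=> [[[M [hM [g gK Kg]]] [C bC]]|[T fT [bT [hT ->]]]].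
  pose T := linear_of (glue_linear c).
  have rangeT : (vertex c : H -> bool) = range_subspace T.
    apply/funext => y; apply/idP/idP => [cy|/mem_rangeP[x <-]].
      apply/mem_rangeP; exists (vec_val (g (Vec cy))).
      by rewrite /= glueE Kg.
    exact: vec_valP.
  have fT : finite_dim (range_subspace T) by rewrite -rangeT; exact: vertexP.
  have bT : bounded_op T by exists C => x; exact: bC.
  exists T => //; split=> //; exists fT.
  by apply: cone_eq => // N hN x; rewrite -glueE.
split; last first.
  by have [C TC] := bT; exists C => M hM x; exact: TC.
have [s sT] := (finite_dimP _).1 hT.
have [y /sT/mem_rangeP//|s' [s's s'T s'0]] := @lspan_section _ _ s T.
exists (span_subspace s'), (finite_dim_span s').
have inv (y : vec (range_subspace T)) :
    exists x : vec (span_subspace s'), restriction T x = y.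
  have /sT/s's[x s'x xy] := vec_valP y.
  by exists (Vec ((mem_span_subspace s' x).2 s'x)); exact/val_inj.
have [g gK] := choice inv; exists g => // x; apply/val_inj/eqP.
rewrite -subr_eq0; apply/eqP/s'0.
  by apply: lspanB; apply/mem_span_subspace/vec_valP.
have /(congr1 (fun v => vec_val v)) /= Tg := gK (restriction T x).
by rewrite linearB /= Tg subrr.
Qed.

End BoundedNormalCones.

Section ConeAlgebra.
Variables (R : realType) (k : scalar_kind).
Local Notation K := (scalars R k).
Variables (H : normedModType K) (P : (H -> bool) -> Prop).
Hypothesis coverP : forall x, exists2 M : Defs.subspace H, P M & x \in M.
Variable S : operator_subalgebra H.
Hypothesis rangeP : forall T, opsub_pred S T -> P (range_subspace T).
Implicit Types T : {linear H -> H}.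

Definition cone_of (a : operator S) : cone P := range_cone (rangeP (op_mem a)).

Lemma represents_cone_of T a : represents T (cone_of a) <-> (T : H -> H) = a.
Proof. exact/represents_range_cone/op_bounded. Qed.

Lemma range_cone_of :
  range cone_of = [set c | exists2 T, opsub_pred S T & represents T c].
Proof.
apply/seteqP; split=> [_ [a _ <-]|c [T ST [bT [hT ->]]]].
  by exists (op_linear a); [exact: op_mem|exact/represents_cone_of].
have [a aT] := exists_operator ST.
exists a => //; rewrite /cone_of; move: (rangeP _); rewrite aT => hT'.
by congr range_cone; exact: Prop_irrelevance.
Qed.

(** The underlying normed algebra depends on S alone, so cones in different
    categories that come from the same operators form isomorphic algebras. *)
Definition cone_operator_algebra C
    (CE : C = [set c | exists2 T, opsub_pred S T & represents T c]) :
  operator_algebra (@represents _ H P) C :=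
  op_operator_algebra (etrans range_cone_of (esym CE)) represents_cone_of.

End ConeAlgebra.

Section Proper.
Variables (K : numFieldType) (H : normedModType K).
Hypothesis infH : ~ finite_dim (xpredT : H -> bool).

Lemma finite_dim_proper (M : Defs.subspace H) :
  finite_dim M -> proper_subspace M.
Proof.
move=> /finite_dimP[s sM]; apply: contra_notP infH => nM.
apply/finite_dimP; exists s => x; split=> // _; apply/sM.
by apply/negPn/negP => Mx; apply: nM; exists x.
Qed.

Lemma proper_cover (x : H) :
  exists2 M : Defs.subspace H, proper_subspace M & x \in M.
Proof.
have [M fM Mx] := finite_dim_cover x.
by exists M => //; exact: finite_dim_proper.
Qed.

End Proper.

Section ProperCones.
Variables (R : realType) (k : scalar_kind).
Local Notation K := (scalars R k).
Variables (H : completeNormedModType K) (dot : {dot H for @scalar_conj R k}).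
Hypothesis dotE : forall x : H, dot x x = `|x| ^+ 2.
Hypothesis infH : ~ finite_dim (xpredT : H -> bool).

Lemma compact_op_proper (T : {linear H -> H}) :
  compact_op T -> proper_subspace (range_subspace T).
Proof.
move=> /(compact_op_not_surjective dotE infH)[y Ty]; exists y.
by apply/negP => /mem_rangeP[x]; exact: Ty.
Qed.

Lemma FPE : FP H = [set c | exists2 T, finite_rank T & represents T c].
Proof.
by apply/seteqP; split=> [c []//|c [T fT Tc]]; split; exists T.
Qed.

(** A norm limit of finite rank operators is compact, and a compact operator is
    such a limit; being not onto, it does define a cone in P(H). *)
Lemma FP_closureE :
  FP_closure H = [set c | exists2 T, compact_op T & represents T c].
Proof.
apply/seteqP; split=> [c [u FPu [T_ [T [Tu Tc Tcvg]]]]|c [T cT Tc]].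
  exists T => //; apply: compact_op_limit => e e0.
  have /cvgrPdist_lt/(_ _ e0)[n _ /(_ n (leqnn n))] := Tcvg.
  rewrite sub0r normrN => Tne; exists (T_ n).
    have [_ [U fU Uu]] := FPu n.
    rewrite (represents_inj (proper_cover infH) (Tu n) Uu).
    exact: (finite_rank_compact dotE).
  move=> x x1; rewrite distrC (le_lt_trans _ Tne)//.
  have b : bounded_op (T_ n \- T).
    have [[C TC] _] := Tc; have [[D TD] _] := Tu n.
    exists (D + C) => y; rewrite (le_trans (ler_normB _ _))// mulrDl.
    exact: lerD.
  rewrite ger0_norm; last exact: opnorm_ge0.
  exact: (@opnorm_ball _ _ _ (T_ n \- T)).
have e0 n : 0 < n.+1%:R^-1 :> K by rewrite invr_gt0.
have approx n : exists U : {linear H -> H},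
    finite_rank U /\ forall x, `|x| <= 1 -> `|T x - U x| <= n.+1%:R^-1.
  by have [U fU TU] := compact_finite_rank_approx dotE cT (e0 n); exists U.
have [T_ T_P] := choice approx.
have fT n : finite_rank (T_ n) := (T_P n).1.
pose u n := range_cone (finite_dim_proper infH (fT n).2).
have uT n : represents (T_ n) (u n).
  by split; [exact: (fT n).1|exists (finite_dim_proper infH (fT n).2)].
exists u; first by move=> n; rewrite FPE; exists (T_ n).
exists T_, T; split=> //; apply/cvgrPdist_lt => e /scalar_invn[n ne].
exists n => // m /= nm; rewrite sub0r normrN.
have Tm x : `|x| <= 1 -> `|T_ m x - T x| <= m.+1%:R^-1.
  by move=> x1; rewrite distrC; exact: (T_P m).2.
have Tm_le := @opnorm_le _ _ _ (T_ m \- T) _ Tm.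
rewrite ger0_norm; last first.
  by apply: opnorm_ge0; exists m.+1%:R^-1; exact: homogeneous_le.
rewrite (le_lt_trans Tm_le)// (le_lt_trans _ ne)// lef_pV2 ?posrE ?ltr0Sn//.
by rewrite ler_nat.
Qed.

End ProperCones.

(** * The two isomorphisms *)

Theorem theorem12 (R : realType) (k : scalar_kind)
    (H : completeNormedModType (scalars R k))
    (dot : {dot H for @scalar_conj R k})
    (dotE : forall x : H, dot x x = `|x| ^+ 2)
    (infinite_dim : ~ finite_dim (xpredT : H -> bool)) :
  (exists (F : operator_algebra (@represents _ H _) (FP H))
          (B : operator_algebra (@represents _ H _) (BF H)),
      isometrically_isomorphic F B) /\
  (exists (A : operator_algebra (@represents _ H _) (FP_closure H))
          (C : operator_algebra (fun T U : {linear H -> H} => U = T)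
                 (compacts H)),
      [/\ banach A, banach C & isometrically_isomorphic A C]).
Proof.
have iso_refl (A : normedAlgebra (scalars R k)) : isometrically_isomorphic A A.
  by exists idfun; split=> //; exists idfun.
have coverP := proper_cover infinite_dim.
split.
  have properT T (fT : finite_rank T) := finite_dim_proper infinite_dim fT.2.
  exists (cone_operator_algebra coverP
    (S := finite_rank_ops H) properT (FPE H)).
  have BFE : BF H = [set c | exists2 T, finite_rank T & represents T c].
    by apply/seteqP; split=> c /bounded_normal_coneP.
  exists (cone_operator_algebra (@finite_dim_cover _ H)
    (S := finite_rank_ops H) (fun T fT => fT.2) BFE).
  exact: iso_refl.
have properT T (cT : compact_op T) := compact_op_proper dotE infinite_dim cT.
exists (cone_operator_algebra coverP (S := compact_ops H) properT
  (FP_closureE dotE infinite_dim)).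
have CE : range (@op_linear _ _ _ (compact_ops H)) = compacts H.
  apply/seteqP; split=> [_ [a _ <-]|T cT]; first exact: (op_mem a).
  by have [a aT] := @exists_operator _ _ _ (compact_ops H) T cT; exists a.
have CP T (a : operator (compact_ops H)) :
    op_linear a = T <-> (T : H -> H) = a.
  by split=> [<-//|Ta]; exact: linear_ext.
exists (op_operator_algebra CE CP).
split; last exact: iso_refl.
  exact: compact_ops_banach.
exact: compact_ops_banach.
Qed.
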